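(* Consider the input-affine dynamics $f(x,u)=f_{\mathrm s}(x)+f_{\mathrm i}(x)\,u$, a grid-like finite discretization $\mathbb{X}^{\mathrm g}\subset\mathbb{X}\subset\mathbb{R}^n$ of the state space of cardinality $X$, a grid-like finite set $\mathbb{Y}^{\mathrm g}\subset\mathbb{R}^n$ of cardinality $Y$, and a discrete cost-to-go $J^{\mathrm d}:\mathbb{X}^{\mathrm g}\to\mathbb{R}$. Assume that (a) the primal and dual grids used in each Linear-time Legendre Transform (LLT) operation have approximately the same cardinality in each dimension, and (b) for the stage cost $C$, the partial conjugate $C_x^*(v)=\max_{u}\{\langle v,u\rangle-C(x,u)\}$, $v\in\mathbb{R}^m$, is analytically available, i.e. evaluating $C_x^*(v)$ for each $v\in\mathbb{R}^m$ has time complexity $\mathcal{O}(1)$. Then the computation of the discrete conjugate dynamic programming (d-CDP) operator $\widehat{\mathcal{T}}^{\mathrm d}[J^{\mathrm d}]:\mathbb{X}^{\mathrm g}\to\mathbb{R}$ by the d-CDP algorithm (Algorithm 1, described in the context) requires $\mathcal{O}(XY)$ operations.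
   Context: Problem data (standing assumptions). $f:\mathbb{R}^n\times\mathbb{R}^m\to\mathbb{R}^n$ is locally Lipschitz; $\mathbb{X}\subset\mathbb{R}^n$ and $\mathbb{U}\subset\mathbb{R}^m$ are compact; the stage cost $C:\mathbb{X}\times\mathbb{U}\to\mathbb{R}\cup\{+\infty\}$ has compact effective domain and is Lipschitz continuous on it; and for every $x\in\mathbb{X}$ the set $\mathbb{U}(x)=\{u\in\mathbb{U}: C(x,u)<+\infty,\ f(x,u)\in\mathbb{X}\}$ is nonempty. Here $f(x,u)=f_{\mathrm s}(x)+f_{\mathrm i}(x)u$ with $f_{\mathrm s}:\mathbb{R}^n\to\mathbb{R}^n$, $f_{\mathrm i}:\mathbb{R}^n\to\mathbb{R}^{n\times m}$. Cost functions are extended by $+\infty$ outside their effective domains. A grid (grid-like set) in $\mathbb{R}^n$ is a Cartesian product of $n$ finite sets of real numbers. d-CDP operator. For $J^{\mathrm d}:\mathbb{X}^{\mathrm g}\to\mathbb{R}$: $J^{\mathrm{d}*\mathrm{d}}(y)=\max_{x\in\mathbb{X}^{\mathrm g}}\{\langle y,x\rangle-J^{\mathrm d}(x)\}$ for $y\in\mathbb{Y}^{\mathrm g}$; $\psi^{\mathrm d}_x(y)=C_x^*(-f_{\mathrm i}(x)^\top y)+J^{\mathrm{d}*\mathrm{d}}(y)$ for $y\in\mathbb{Y}^{\mathrm g}$; $\widehat{\mathcal{T}}^{\mathrm d}[J^{\mathrm d}](x)=\max_{y\in\mathbb{Y}^{\mathrm g}}\{\langle f_{\mathrm s}(x),y\rangle-\psi^{\mathrm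 d}_x(y)\}$ for $x\in\mathbb{X}^{\mathrm g}$. Algorithm 1. Step 1: use LLT to compute $J^{\mathrm{d}*\mathrm{d}}:\mathbb{Y}^{\mathrm g}\to\mathbb{R}$ from $J^{\mathrm d}:\mathbb{X}^{\mathrm g}\to\mathbb{R}$. Step 2: for each $x\in\mathbb{X}^{\mathrm g}$, compute $\psi^{\mathrm d}_x(y)$ for all $y\in\mathbb{Y}^{\mathrm g}$ and then compute $\widehat{\mathcal{T}}^{\mathrm d}[J^{\mathrm d}](x)$ by enumeration over $y\in\mathbb{Y}^{\mathrm g}$. Complexity conventions. Complexity is measured in terms of the sizes of the finite sets only: the dimensions $n,m$ are regarded as fixed (hidden constants may depend on them), and a single evaluation of an analytically available function (such as $f_{\mathrm s}$, $f_{\mathrm i}$) costs $\mathcal{O}(1)$. LLT is a known algorithm which, given $h^{\mathrm d}$ on a grid with $X_i$ points in dimension $i$ and a dual grid with $Y_i$ points in dimension $i$, computes the discrete conjugate of $h^{\mathrm d}$ on the dual grid in $\mathcal{O}\big(\prod_{i=1}^n(X_i+Y_i)\big)$ operations; when the two grids have approximately the same cardinality in each dimension (assumption (a)), this is $\mathcal{O}(X+Y)$, with $X=\prod_i X_i$, $Y=\prod_i Y_i$. *)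

(* Defs.v *)
From HB Require Import structures.
From mathcomp Require Import all_boot all_order all_algebra.
From mathcomp Require Import all_classical all_reals all_analysis.

Set Implicit Arguments.
Unset Strict Implicit.
Unset Printing Implicit Defensive.

Import Order.TTheory GRing.Theory Num.Theory.
Import numFieldNormedType.Exports.

Local Open Scope classical_set_scope.
Local Open Scope ring_scope.

Section Grids.
Variable n : nat.

(* A grid with [s i] points along axis [i]. [V] is the type of numbers: the
   reals in statements, an abstract type in programs. *)
Definition grid (V : Type) (s : 'I_n -> nat) := forall i, (s i).-tuple V.

Definition gidx (s : 'I_n -> nat) := {dffun forall i : 'I_n, 'I_(s i)}.

Definition gpoint V s (g : grid V s) (k : gidx s) : 'cV[V]_n :=
  \col_i tnth (g i) (k i).

(* The nonempty finite set of coordinates along an axis is represented by its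
   strictly increasing enumeration; hence [gpoint g] is injective, [gidx s] is
   in bijection with the grid, and functions on the grid are functions on
   [gidx s]. *)
Definition proper_grid (R : realType) s (g : grid R s) : Prop :=
  forall i, (0 < s i)%N /\ sorted <%R (g i).

Definition gset (R : realType) s (g : grid R s) : set 'cV[R]_n :=
  range (gpoint g).

Definition gcard (s : 'I_n -> nat) : nat := #|{: gidx s}|.

Definition similar_sizes (kappa : nat) (s t : 'I_n -> nat) : Prop :=
  forall i, (s i <= kappa * t i)%N /\ (t i <= kappa * s i)%N.

End Grids.

Section Problem.
Variables (R : realType) (n m : nat).

Definition inner p (u v : 'cV[R]_p) : R := \sum_i u i ord0 * v i ord0.

Record problem := Problem {
  fs : 'cV[R]_n -> 'cV[R]_n;
  fi : 'cV[R]_n -> 'M[R]_(n, m);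
  state_set : set 'cV[R]_n;
  input_set : set 'cV[R]_m;
  stage_cost : 'cV[R]_n -> 'cV[R]_m -> \bar R }.

Definition dynamics (P : problem) (z : 'cV[R]_n * 'cV[R]_m) : 'cV[R]_n :=
  fs P z.1 + fi P z.1 *m z.2.

Definition cost_dom (P : problem) : set ('cV[R]_n * 'cV[R]_m) :=
  [set z | (stage_cost P z.1 z.2 < +oo)%E].

Definition admissible_inputs (P : problem) (x : 'cV[R]_n) : set 'cV[R]_m :=
  [set u | [/\ input_set P u, (stage_cost P x u < +oo)%E
             & state_set P (dynamics P (x, u))]].

(* The stage cost is defined on the whole space, extended by +oo. *)
Record standing_assumptions (P : problem) : Prop := StandingAssumptions {
  dynamics_loc_lip : forall z : 'cV[R]_n * 'cV[R]_m, exists2 A, nbhs z A &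
    [lipschitz dynamics P x | x in A];
  state_compact : compact (state_set P);
  input_compact : compact (input_set P);
  cost_not_Noo : forall x u, stage_cost P x u != -oo%E;
  cost_dom_sub : cost_dom P `<=` state_set P `*` input_set P;
  cost_dom_compact : compact (cost_dom P);
  cost_lip : [lipschitz (fine (stage_cost P z.1 z.2) : R^o)
             | z in cost_dom P];
  feasible : forall x, state_set P x -> admissible_inputs P x !=set0 }.

Definition partial_conj (P : problem) (x : 'cV[R]_n) (v : 'cV[R]_m) : \bar R :=
  ereal_sup (range (fun u => ((inner v u)%:E - stage_cost P x u)%E)).

(* Maxima over (nonempty) grids are taken in the extended reals, where -oo is
   neutral. *)
Definition dconj s (g : grid R s) (h : gidx s -> R) (y : 'cV[R]_n) : \bar R :=
  (\big[maxe/-oo]_(k : gidx s) ((inner y (gpoint g k))%:E - (h k)%:E))%E.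

Definition psi (P : problem) sx (gx : grid R sx) (J : gidx sx -> R)
    (x y : 'cV[R]_n) : \bar R :=
  (partial_conj P x (- ((fi P x)^T *m y)) + dconj gx J y)%E.

Definition dCDP (P : problem) sx sy (gx : grid R sx) (gy : grid R sy)
    (J : gidx sx -> R) (x : 'cV[R]_n) : \bar R :=
  (\big[maxe/-oo]_(k : gidx sy)
     ((inner (fs P x) (gpoint gy k))%:E - psi P gx J x (gpoint gy k)))%E.

End Problem.

(* Real-RAM programs over an abstract type [V] of numbers: a program that is
   polymorphic in [V] can obtain, combine and compare numbers only through the
   charged instructions below. [Copy] is a transfer between memory cells; the
   three [Eval] instructions evaluate f_s, f_i and C_x^*. *)
Inductive arith : Type := Add | Sub | Mul | Div.

Inductive prog (n m : nat) (V A : Type) : Type :=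
| Ret of A
| Lit of int & (V -> prog n m V A)
| Arith of arith & V & V & (V -> prog n m V A)
| Leq of V & V & (bool -> prog n m V A)
| Copy of V & (V -> prog n m V A)
| EvalFs of 'cV[V]_n & ('cV[V]_n -> prog n m V A)
| EvalFi of 'cV[V]_n & ('M[V]_(n, m) -> prog n m V A)
| EvalConj of 'cV[V]_n & 'cV[V]_m & (V -> prog n m V A).

Arguments Ret {n m V A}.

Fixpoint bind n m V A B (p : prog n m V A) (f : A -> prog n m V B) :
    prog n m V B :=
  match p with
  | Ret a => f a
  | Lit z k => Lit z (fun r => bind (k r) f)
  | Arith o x y k => Arith o x y (fun r => bind (k r) f)
  | Leq x y k => Leq x y (fun b => bind (k b) f)
  | Copy x k => Copy x (fun r => bind (k r) f)
  | EvalFs x k => EvalFs x (fun r => bind (k r) f)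
  | EvalFi x k => EvalFi x (fun r => bind (k r) f)
  | EvalConj x v k => EvalConj x v (fun r => bind (k r) f)
  end.

Declare Scope prog_scope.
Delimit Scope prog_scope with prog.
Notation "x <-- p ;; q" := (bind p (fun x => q))
  (at level 100, p at next level, right associativity) : prog_scope.

Record evaluator (R : realType) (n m : nat) := Evaluator {
  fs_val : 'cV[R]_n -> 'cV[R]_n;
  fi_val : 'cV[R]_n -> 'M[R]_(n, m);
  conj_val : 'cV[R]_n -> 'cV[R]_m -> R;
  fs_time : 'cV[R]_n -> nat;
  fi_time : 'cV[R]_n -> nat;
  conj_time : 'cV[R]_n -> 'cV[R]_m -> nat }.

Definition arith_val (R : realType) (o : arith) (x y : R) : R :=
  match o with
  | Add => x + y
  | Sub => x - y
  | Mul => x * y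
  | Div => x / y
  end.

Section Execution.
Variables (R : realType) (n m : nat) (E : evaluator R n m).

Fixpoint result A (p : prog n m R A) : A :=
  match p with
  | Ret a => a
  | Lit z k => result (k z%:~R)
  | Arith o x y k => result (k (arith_val o x y))
  | Leq x y k => result (k (x <= y))
  | Copy x k => result (k x)
  | EvalFs x k => result (k (fs_val E x))
  | EvalFi x k => result (k (fi_val E x))
  | EvalConj x v k => result (k (conj_val E x v))
  end.

Fixpoint op_count A (p : prog n m R A) : nat :=
  match p with
  | Ret _ => 0
  | Lit z k => 1 + op_count (k z%:~R)
  | Arith o x y k => 1 + op_count (k (arith_val o x y))
  | Leq x y k => 1 + op_count (k (x <= y)%R)
  | Copy x k => 1 + op_count (k x)
  | EvalFs x k => fs_time E x + op_count (k (fs_val E x))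
  | EvalFi x k => fi_time E x + op_count (k (fi_val E x))
  | EvalConj x v k => conj_time E x v + op_count (k (conj_val E x v))
  end%N.

End Execution.

Definition problem_evaluator (R : realType) (n m : nat) (P : problem R n m)
    (tfs tfi : 'cV[R]_n -> nat) (tconj : 'cV[R]_n -> 'cV[R]_m -> nat) :
    evaluator R n m :=
  Evaluator (fs P) (fi P) (fun x v => fine (partial_conj P x v)) tfs tfi tconj.

Section Subroutines.
Variables (n m : nat) (V : Type).
Local Open Scope prog_scope.
Local Notation prog := (prog n m V).

Definition lit (z : int) : prog V := Lit z Ret.
Definition arith_op (o : arith) (x y : V) : prog V := Arith o x y Ret.
Definition leq_op (x y : V) : prog bool := Leq x y Ret.
Definition copy (x : V) : prog V := Copy x Ret.
Definition eval_fs (x : 'cV[V]_n) : prog 'cV[V]_n := EvalFs x Ret.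
Definition eval_fi (x : 'cV[V]_n) : prog 'M[V]_(n, m) := EvalFi x Ret.
Definition eval_conj (x : 'cV[V]_n) (v : 'cV[V]_m) : prog V :=
  EvalConj x v Ret.

Fixpoint fold_prog (I A : Type) (s : seq I) (body : A -> I -> prog A) (a : A) :
    prog A :=
  if s is i :: s' then b <-- body a i ;; fold_prog s' body b else Ret a.

Definition tabulate (I : finType) (F : I -> prog V) : prog (I -> V) :=
  z <-- lit 0 ;;
  fold_prog (enum I)
    (fun t i =>
       r <-- F i ;;
       c <-- copy r ;;
       Ret (fun j => if j == i then c else t j))
    (fun _ => z).

Definition maximize (I : finType) (F : I -> prog V) : prog V :=
  if enum I is i :: s then
    r <-- F i ;;
    fold_prog s
      (fun best j =>
         c <-- F j ;;
         b <-- leq_op best c ;;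
         Ret (if b then c else best))
      r
  else lit 0.

Definition vec_prog p (F : 'I_p -> prog V) : prog 'cV[V]_p :=
  t <-- tabulate F ;; Ret (\col_i t i).

Definition inner_prog p (u v : 'cV[V]_p) : prog V :=
  z <-- lit 0 ;;
  fold_prog (enum 'I_p)
    (fun acc i =>
       t <-- arith_op Mul (u i ord0) (v i ord0) ;;
       arith_op Add acc t)
    z.

Definition load_point s (g : grid V s) (k : gidx s) : prog 'cV[V]_n :=
  vec_prog (fun i => copy (tnth (g i) (k i))).

End Subroutines.

Arguments lit {n m V}.
Arguments arith_op {n m V}.
Arguments leq_op {n m V}.
Arguments copy {n m V}.
Arguments eval_fs {n m V}.
Arguments eval_fi {n m V}.
Arguments eval_conj {n m V}.
Arguments inner_prog {n m V p}.
Arguments load_point {n m V s}.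

Definition dual_transform (n m : nat) : Type :=
  forall (V : Type) (sx sy : 'I_n -> nat) (gx : grid V sx) (gy : grid V sy)
    (h : gidx sx -> V), prog n m V (gidx sy -> V).

(* The known properties of the Linear-time Legendre Transform: it returns the
   discrete conjugate of [h] at the points of the dual grid, within
   cL * prod_i (X_i + Y_i) operations. *)
Definition is_LLT (R : realType) (n m : nat) (cL : nat)
    (LLT : dual_transform n m) : Prop :=
  forall (E : evaluator R n m) (sx sy : 'I_n -> nat)
    (gx : grid R sx) (gy : grid R sy) (h : gidx sx -> R),
  proper_grid gx -> proper_grid gy ->
  (forall k : gidx sy,
     (result E (LLT R sx sy gx gy h) k)%:E = dconj gx h (gpoint gy k)) /\
  (op_count E (LLT R sx sy gx gy h) <= cL * \prod_i (sx i + sy i))%N.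

Section Algorithm.
Variables (n m : nat) (LLT : dual_transform n m).
Variables (V : Type) (sx sy : 'I_n -> nat) (gx : grid V sx) (gy : grid V sy).
Local Open Scope prog_scope.

Definition dCDP_at (Jdd : gidx sy -> V) (k : gidx sx) : prog n m V V :=
  x <-- load_point gx k ;;
  a <-- eval_fs x ;;
  B <-- eval_fi x ;;
  psix <-- tabulate (fun l : gidx sy =>
    y <-- load_point gy l ;;
    v <-- vec_prog (fun j : 'I_m =>
            d <-- inner_prog (col j B) y ;;
            z <-- lit 0 ;;
            arith_op Sub z d) ;;
    c <-- eval_conj x v ;;
    q <-- copy (Jdd l) ;;
    arith_op Add c q) ;;
  maximize (fun l : gidx sy =>
    y <-- load_point gy l ;;
    d <-- inner_prog a y ;;
    q <-- copy (psix l) ;;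
    arith_op Sub d q).

Definition dCDP_algorithm (J : gidx sx -> V) : prog n m V (gidx sx -> V) :=
  Jdd <-- LLT gx gy J ;;
  tabulate (dCDP_at Jdd).

End Algorithm.

(* Main.v *)
Require Import Defs.
From HB Require Import structures.
From mathcomp Require Import all_boot all_order all_algebra.
From mathcomp Require Import all_classical all_reals all_analysis.
From mathcomp Require Import zify.

Import Order.TTheory GRing.Theory Num.Theory.
Import numFieldNormedType.Exports.

Local Open Scope classical_set_scope.
Local Open Scope ring_scope.

(** Correctness and the operation count both follow the structure of the
    program: [result_bind] and [op_count_bind] split a sequential composition,
    so each subroutine gets one lemma for what it returns and one for a bound
    on its cost.

    Correctness compares a program over real numbers with maxima and suprema
    in the extended reals. Every quantity involved has to be finite: the
    discrete conjugate is, because the transform returns real numbers equal to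
    it, and [C_x^*(v)] is, because over the compact domain of the stage cost
    both [<v, u>] and [C] are bounded, the latter as a Lipschitz function, and
    because some input is admissible at [x] ([partial_conj_fin_num]).

    For the cost, the transform takes [cL * prod_i (X_i + Y_i)] operations,
    and [Y_i <= kappa * X_i] turns this into [cL * (kappa + 1)^n * X], which
    is below [cL * (kappa + 1)^n * X * Y] since [Y >= 1]. Each of the [X]
    state grid points then costs a constant plus two enumerations of the dual
    grid, one for [psi] and one for the maximum, each of whose [Y] steps takes
    a number of operations that depends on [n], [m] and the evaluation times
    only. As [X] and [Y] are positive, all lower-order terms are absorbed in
    [X * Y]. *)

(** * Finiteness of the partial conjugate *)

(** With Lipschitz constant [k], all values stay within [k * diam A] of the
    value at any one point of [A]. *)
Lemma lipschitz_bounded {R : realType} {V W : normedModType R} {f : V -> W}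
    {A : set V} :
  bounded_set A -> [lipschitz f z | z in A] ->
  exists M, forall z, A z -> `|f z| <= M.
Proof.
move=> bA lipA.
have [[z0 Az0]|A0] := pselect (A !=set0); last first.
  by exists 0 => z Az; case: A0; exists z.
have [b bAb] : exists b, forall z, A z -> `|z| <= b.
  by have [b _] := pinfty_ex_gt0 bA; exists b.
near (pinfty_nbhs R) => k.
have k0 : 0 <= k by near: k; exact: nbhs_pinfty_ge.
exists (`|f z0| + k * (b + b)) => z Az.
rewrite -[f z](subrK (f z0)) addrC (le_trans (ler_normD _ _))// lerD2l.
have /(_ (z, z0) (conj Az Az0))/= /le_trans -> // : k.-lipschitz_A f by near: k.
by rewrite ler_wpM2l// (le_trans (ler_normB _ _))// lerD// bAb.
Unshelve. all: by end_near. Qed.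

Lemma inner_le_norm {R : realType} {p} (v u : 'cV[R]_p) :
  inner v u <= (\sum_i `|v i ord0|) * `|u|.
Proof.
rewrite /inner mulr_suml ler_sum// => i _.
rewrite (le_trans (ler_norm _))// normrM ler_wpM2l//.
rewrite [leRHS]/Num.Def.normr/= mx_normrE.
by apply/bigmax_geP; right => /=; exists (i, ord0).
Qed.

(** An admissible input at [x] makes one term of the supremum real, which
    excludes [-oo]. Terms with [C(x, u) = +oo] are [-oo], and the others have
    [(x, u)] in the domain of the cost, where [<v, u>] and [C] are bounded;
    this excludes [+oo]. *)
Lemma partial_conj_fin_num {R : realType} {n m} (P : problem R n m) x v :
  standing_assumptions P -> state_set P x -> partial_conj P x v \is a fin_num.
Proof.
move=> SP xP; have bdom := compact_bounded (cost_dom_compact SP).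
have [M CM] := lipschitz_bounded bdom (cost_lip SP).
have [b bb] : exists b, forall z, cost_dom P z -> `|z| <= b.
  by have [b _] := pinfty_ex_gt0 bdom; exists b.
have Cfin u : (stage_cost P x u < +oo)%E -> stage_cost P x u \is a fin_num.
  by move=> Cu; rewrite fin_numE cost_not_Noo//= lt_eqF.
have [u0 [_ Cu0 _]] := feasible SP xP.
have lower : (-oo < partial_conj P x v)%E.
  apply: (@lt_le_trans _ _ ((inner v u0)%:E - stage_cost P x u0)%E).
    by rewrite -(fineK (Cfin _ Cu0)) -EFinB ltNyr.
  by apply: ereal_sup_ubound; exists u0.
have upper : (partial_conj P x v <= ((\sum_i `|v i ord0|) * b + M)%:E)%E.
  apply: ge_ereal_sup => _ [u _ <-].
  have [Cu|] := boolP (stage_cost P x u < +oo)%E; last first.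
    by rewrite ltey negbK => /eqP ->; rewrite /= leNye.
  have zdom : cost_dom P (x, u) by [].
  rewrite -(fineK (Cfin _ Cu)) -EFinB lee_fin lerD//; last first.
    by rewrite (le_trans (ler_norm _))// normrN; exact: CM zdom.
  rewrite (le_trans (inner_le_norm _ _))// ler_wpM2l ?sumr_ge0//.
  by apply: le_trans (bb _ zdom); rewrite [leRHS]prod_normE/= le_max lexx orbT.
by rewrite fin_real// lower (le_lt_trans upper)// ltry.
Qed.

(** * Results and operation counts of the subroutines *)

Section Subroutines.
Context {R : realType} {n m : nat} (E : evaluator R n m).

Lemma result_bind {A B} (p : prog n m R A) (f : A -> prog n m R B) :
  result E (bind p f) = result E (f (result E p)).
Proof. by elim: p => /=. Qed.

(** The count of the continuation is taken at the value actually returned, as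
    the evaluation times may depend on their arguments. *)
Lemma op_count_bind {A B} (p : prog n m R A) (f : A -> prog n m R B) :
  op_count E (bind p f) = (op_count E p + op_count E (f (result E p)))%N.
Proof. by elim: p => //= *; rewrite -addnA; congr (_ + _)%N. Qed.

Lemma op_count_fold_prog_le {I A : Type} (s : seq I)
    (body : A -> I -> prog n m R A) (a : A) {c : nat} :
  (forall b i, op_count E (body b i) <= c)%N ->
  (op_count E (fold_prog s body a) <= size s * c)%N.
Proof.
move=> bc; elim: s a => //= i s IH a.
by rewrite op_count_bind mulSn leq_add.
Qed.

(** The program overwrites one entry at a time of a table that is initially
    zero, and every index is visited. *)
Lemma result_tabulate {I : finType} (F : I -> prog n m R R) (i : I) :
  result E (tabulate F) i = result E (F i).
Proof.
rewrite /tabulate/=; set t0 := fun _ : I => _.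
(* After visiting only [s], the other entries are those of the initial [t]. *)
suff gen s t : result E (fold_prog s (fun t i =>
    bind (F i) (fun r => bind (copy r) (fun c =>
      Ret (fun j => if j == i then c else t j)))) t) i =
    if i \in s then result E (F i) else t i.
  by rewrite gen mem_enum.
elim: s t => //= j s IH t; rewrite result_bind IH result_bind/= in_cons.
by have [->|_]/= := eqVneq i j; case: ifP.
Qed.

(** Each entry costs its computation and one copy; creating the table costs one
    more operation. *)
Lemma op_count_tabulate_le {I : finType} (F : I -> prog n m R R) {c : nat} :
  (forall i, op_count E (F i) <= c)%N ->
  (op_count E (tabulate F) <= #|I| * c.+1 + 1)%N.
Proof.
move=> Fc; rewrite /tabulate/= addnC leq_add2r cardE.
apply: op_count_fold_prog_le => t i.
by rewrite op_count_bind/= addn0 addn1 ltnS.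
Qed.

(** The running maximum starts at the first value, not at [-oo], hence the
    nonemptiness hypothesis; [-oo] is neutral for the extended maximum. *)
Lemma result_maximize {I : finType} (F : I -> prog n m R R) :
  (0 < #|I|)%N ->
  (result E (maximize F))%:E = \big[maxe/-oo%E]_i (result E (F i))%:E.
Proof.
rewrite /maximize -big_enum/= cardE; case: (enum I) => // i s _.
rewrite result_bind big_cons; move: (result E (F i)) => a.
elim: s a => [|j s IH] a /=; first by rewrite big_nil maxeNy.
rewrite !result_bind/= IH big_cons maxA -EFin_max.
by rewrite /Num.max; case: ltgtP => // ->.
Qed.

(** Each candidate costs its computation and at most one comparison; the final
    [1] covers the case of an empty index type. *)
Lemma op_count_maximize_le {I : finType} (F : I -> prog n m R R) {c : nat} :
  (forall i, op_count E (F i) <= c)%N ->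
  (op_count E (maximize F) <= #|I| * c.+1 + 1)%N.
Proof.
move=> Fc; rewrite /maximize cardE; case: (enum I) => //= i s.
rewrite op_count_bind mulSn -addnA leq_add//; first exact: leqW.
apply/(leq_trans _ (leq_addr 1 _))/op_count_fold_prog_le => b j.
by rewrite op_count_bind/= addn1 ltnS.
Qed.

Lemma result_vec_prog {p} (F : 'I_p -> prog n m R R) :
  result E (vec_prog F) = \col_i result E (F i).
Proof.
by rewrite result_bind; apply/matrixP => i j; rewrite !mxE result_tabulate.
Qed.

Lemma op_count_vec_prog_le {p} (F : 'I_p -> prog n m R R) {c : nat} :
  (forall i, op_count E (F i) <= c)%N ->
  (op_count E (vec_prog F) <= p * c.+1 + 1)%N.
Proof.
move=> Fc; rewrite op_count_bind addn0 -[p in leqRHS]card_ord.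
exact: op_count_tabulate_le.
Qed.

Lemma result_inner_prog {p} (u v : 'cV[R]_p) :
  result E (inner_prog u v) = inner u v.
Proof.
rewrite /inner_prog/= /inner -big_enum/=.
set body := fun acc i => _.
suff gen s a : result E (fold_prog s body a) =
    a + \sum_(i <- s) u i ord0 * v i ord0 by rewrite gen add0r.
elim: s a => [|i s IH] a /=; first by rewrite big_nil addr0.
by rewrite IH big_cons addrA.
Qed.

Lemma op_count_inner_prog_le {p} (u v : 'cV[R]_p) :
  (op_count E (inner_prog u v) <= p * 2 + 1)%N.
Proof.
rewrite /inner_prog/= addnC leq_add2r -[p in leqRHS]card_ord cardE.
exact: op_count_fold_prog_le.
Qed.

Lemma result_load_point {s} (g : grid R s) (k : gidx s) :
  result E (load_point g k) = gpoint g k.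
Proof. by rewrite result_vec_prog. Qed.

Lemma op_count_load_point_le {s} (g : grid R s) (k : gidx s) :
  (op_count E (load_point g k) <= n * 2 + 1)%N.
Proof. exact: op_count_vec_prog_le. Qed.

End Subroutines.

(** * Grid cardinalities *)

Lemma gcardE {n} (s : 'I_n -> nat) : gcard s = (\prod_i s i)%N.
Proof.
rewrite /gcard card_dep_ffun foldrE big_image/=.
by apply: eq_bigr => i _; rewrite card_ord.
Qed.

Lemma gcard_gt0 {R : realType} {n} {s : 'I_n -> nat} {g : grid R s} :
  proper_grid g -> (0 < gcard s)%N.
Proof. by move=> gP; rewrite gcardE prodn_gt0// => i; case: (gP i). Qed.

(** This is where comparable grid sizes matter: axis by axis,
    [s i + t i <= (kappa + 1) * s i]. Without it the product could contain
    mixed terms such as [s 0 * t 1] that no multiple of [gcard s] bounds. *)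
Lemma prod_addn_similar_le {n kappa} {s t : 'I_n -> nat} :
  similar_sizes kappa s t ->
  (\prod_i (s i + t i) <= kappa.+1 ^ n * gcard s)%N.
Proof.
move=> st; rewrite gcardE -[n in (_ ^ n)%N]card_ord -prod_nat_const -big_split.
by apply: leq_prod => i _; rewrite /= mulSn leq_add2l; case: (st i).
Qed.

(** * Correctness at a grid point *)

Section Algorithm.
Context {R : realType} {n m : nat} {P : problem R n m}.
Context (sx sy : 'I_n -> nat) (gx : grid R sx) (gy : grid R sy).
Context (tfs tfi : 'cV[R]_n -> nat) (tconj : 'cV[R]_n -> 'cV[R]_m -> nat).
Context (Jdd : gidx sy -> R) (k : gidx sx).
Hypotheses (gyP : proper_grid gy) (gxkP : state_set P (gpoint gx k)).
Let E := problem_evaluator P tfs tfi tconj.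

(** The two finiteness facts allow passing from real sums and differences to
    the extended ones: [JddE] for the discrete conjugate, and
    [partial_conj_fin_num] for the value [fine (partial_conj P x v)] supplied
    by the evaluator. *)
Lemma result_dCDP_at (J : gidx sx -> R) :
  standing_assumptions P ->
  (forall l, (Jdd l)%:E = dconj gx J (gpoint gy l)) ->
  (result E (dCDP_at m gx gy Jdd k))%:E = dCDP P gx gy J (gpoint gx k).
Proof.
move=> SP JddE; rewrite /dCDP_at result_bind result_load_point.
rewrite 3!result_bind result_maximize ?(gcard_gt0 gyP)//.
apply: eq_bigr => l _.
rewrite result_bind result_load_point result_bind result_inner_prog.
rewrite result_bind result_tabulate result_bind result_load_point result_bind.
(* Abbreviating the vector keeps the simplification below from unfolding the
   program that computes it. *)
set v := result _ (vec_prog _).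
have -> : v = - ((fi P (gpoint gx k))^T *m gpoint gy l).
  rewrite /v result_vec_prog; apply/matrixP => j j0.
  rewrite !mxE result_bind result_inner_prog /= sub0r; congr (- _).
  by apply: eq_bigr => i _; rewrite !mxE.
rewrite /= EFinB EFinD; congr (_ - (_ + _))%E; last exact: JddE.
by rewrite fineK ?partial_conj_fin_num.
Qed.

End Algorithm.

(** * Operation count *)

(** The operations that one dual grid point causes at one state grid point:
    [psi] for its entry in the table of [psi], and [objective] for its
    candidate value in the final maximum. Each successor accounts for storing
    an entry or comparing a candidate. *)
Definition dual_point_cost (n m cC : nat) : nat :=
  let point := (n * 2 + 1)%N in
  let psi := (point + (m * (point + 2).+1 + 1) + cC + 2)%N in
  let objective := (point + point + 2)%N in
  (psi.+1 + objective.+1)%N.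

(** The hidden constant of the theorem: the first summand comes from the
    Legendre transform, the second from the work at the grid points, and [5]
    collects the bookkeeping operations at each state and of the outer
    table. *)
Definition dCDP_cost (n m cL kappa cs ci cC : nat) : nat :=
  (cL * kappa.+1 ^ n + (n * 2 + cs + ci + dual_point_cost n m cC) + 5)%N.

Section AlgorithmCost.
Context {R : realType} {n m : nat} {P : problem R n m}.
Context {sx sy : 'I_n -> nat} {gx : grid R sx} {gy : grid R sy}.
Context {tfs tfi : 'cV[R]_n -> nat} {tconj : 'cV[R]_n -> 'cV[R]_m -> nat}.
Context {cs ci cC : nat}.
Hypothesis tfs_le : forall x, (tfs x <= cs)%N.
Hypothesis tfi_le : forall x, (tfi x <= ci)%N.
Hypothesis tconj_le : forall x, state_set P x -> forall v, (tconj x v <= cC)%N.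
Let E := problem_evaluator P tfs tfi tconj.

(** The bound on the time of [C_x^*] holds for states only, whence the
    hypothesis on the grid point. *)
Lemma op_count_dCDP_at_le (Jdd : gidx sy -> R) (k : gidx sx) :
  state_set P (gpoint gx k) ->
  (op_count E (dCDP_at m gx gy Jdd k) <=
     n * 2 + cs + ci + 3 + gcard sy * dual_point_cost n m cC)%N.
Proof.
move=> xP; pose point := (n * 2 + 1)%N.
(* The summands are the costs of the five consecutive steps of the program,
   nested in the order in which they are composed. *)
apply: (@leq_trans (point + (cs + (ci +
  ((gcard sy * (point + ((m * (point + 2).+1 + 1) + (cC + 2))).+1 + 1) +
   (gcard sy * (point + (point + 2)).+1 + 1))))))%N; last first.
  by rewrite /dual_point_cost /point mulnDr; lia.
rewrite op_count_bind result_load_point.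
apply: leq_add; first exact: op_count_load_point_le.
rewrite op_count_bind; apply: leq_add; first by rewrite /= addn0.
rewrite op_count_bind; apply: leq_add; first by rewrite /= addn0.
rewrite op_count_bind; apply: leq_add.
  apply: op_count_tabulate_le => l; rewrite op_count_bind result_load_point.
  apply: leq_add; first exact: op_count_load_point_le.
  rewrite op_count_bind; apply: leq_add; last by rewrite /= leq_add2r tconj_le.
  apply: op_count_vec_prog_le => j.
  by rewrite op_count_bind leq_add// op_count_inner_prog_le.
apply: op_count_maximize_le => l; rewrite op_count_bind.
apply: leq_add; first exact: op_count_load_point_le.
by rewrite op_count_bind leq_add// op_count_inner_prog_le.
Qed.

Lemma op_count_dCDP_algorithm_le {LLT : dual_transform n m} {cL kappa : nat}
    {J : gidx sx -> R} :
  is_LLT R cL LLT ->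
  proper_grid gx -> gset gx `<=` state_set P -> proper_grid gy ->
  similar_sizes kappa sx sy ->
  (op_count E (dCDP_algorithm LLT gx gy J) <=
     dCDP_cost n m cL kappa cs ci cC * (gcard sx * gcard sy))%N.
Proof.
move=> LLTP gxP gxS gyP sxy; rewrite op_count_bind.
have Y0 := gcard_gt0 gyP; have X0 := gcard_gt0 gxP.
have LLT_le := (LLTP E sx sy gx gy J gxP gyP).2.
have tab_le : (op_count E (tabulate (dCDP_at m gx gy
    (result E (LLT R sx sy gx gy J)))) <= gcard sx *
    (n * 2 + cs + ci + 3 + gcard sy * dual_point_cost n m cC).+1 + 1)%N.
  apply: op_count_tabulate_le => k; apply: op_count_dCDP_at_le.
  by apply: gxS; exists k.
apply: leq_trans (leq_add LLT_le tab_le) _.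
have prod_le := prod_addn_similar_le sxy.
have XXY : (gcard sx <= gcard sx * gcard sy)%N by rewrite leq_pmulr.
have XY0 : (0 < gcard sx * gcard sy)%N by rewrite muln_gt0 X0.
have {LLT_le prod_le} LLT_XY : (cL * \prod_i (sx i + sy i) <=
    cL * kappa.+1 ^ n * (gcard sx * gcard sy))%N.
  rewrite -mulnA leq_mul2l; apply/orP; right.
  by apply: leq_trans prod_le _; rewrite leq_mul2l XXY orbT.
rewrite /dCDP_cost; move: LLT_XY XXY XY0 => {tab_le Y0 X0}.
move: (gcard sx) (gcard sy) (dual_point_cost _ _ _) (cL * kappa.+1 ^ n)%N.
move=> X Y D L; nia.
Qed.

End AlgorithmCost.

(** * Correctness and complexity of the algorithm *)

Theorem theorem4p3 (R : realType) (n m : nat)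
    (LLT : dual_transform n m) (cL : nat) (hLLT : is_LLT R cL LLT)
    (kappa cs ci cC : nat) :
  exists K : nat,
  forall (P : problem R n m) (sx sy : 'I_n -> nat)
    (gx : grid R sx) (gy : grid R sy) (J : gidx sx -> R)
    (tfs tfi : 'cV[R]_n -> nat) (tconj : 'cV[R]_n -> 'cV[R]_m -> nat),
  standing_assumptions P ->
  proper_grid gx -> gset gx `<=` state_set P -> proper_grid gy ->
  similar_sizes kappa sx sy ->
  (forall x, (tfs x <= cs)%N) ->
  (forall x, (tfi x <= ci)%N) ->
  (forall x, state_set P x -> forall v, (tconj x v <= cC)%N) ->
  let E := problem_evaluator P tfs tfi tconj in
  let alg := dCDP_algorithm LLT gx gy J in
  (forall k : gidx sx,
     (result E alg k)%:E = dCDP P gx gy J (gpoint gx k)) /\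
  (op_count E alg <= K * (gcard sx * gcard sy))%N.
Proof.
exists (dCDP_cost n m cL kappa cs ci cC) => P sx sy gx gy J tfs tfi tconj.
move=> SP gxP gxS gyP sxy tfs_le tfi_le tconj_le; split; last first.
  exact: op_count_dCDP_algorithm_le.
move=> k; rewrite result_bind result_tabulate; apply: result_dCDP_at => //.
  by apply: gxS; exists k.
by move=> l; case: (hLLT (problem_evaluator P tfs tfi tconj) sx sy gx gy J).
Qed.
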